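(* Fix a positive integer $n$ and integers $w_1\geq\cdots\geq w_n\geq 0$, and set $d^1_{\underline{w}}=n^3\cdot w_1\cdot(2n+w_1)$. For every integer $d\geq d^1_{\underline{w}}$ and every tuple of integers $C_1\geq\cdots\geq C_n$ for which $\mathfrak{BP}(d,\underline{C};\underline{w})$ is $1$-feasible, if in addition $$C_1+\cdots+C_n\geq d\cdot(w_1+\cdots+w_n)+b(\underline{w}),$$ then $\mathfrak{BP}(d,\underline{C};\underline{w})$ is feasible.
   Context: Partitioning problem: fix $n\geq 1$, weights $w_1\geq\cdots\geq w_n\geq 0$ (integers), a positive integer $d$ and integer capacities $C_1\geq\cdots\geq C_n$. Let $\mathcal{B}$ be the multiset of $d\cdot n$ balls consisting of $d$ balls of weight $w_i$ for each $i$. An assignment is a partition $\mathcal{B}=\mathcal{B}_1\sqcup\cdots\sqcup\mathcal{B}_n$ with each $\mathcal{B}_i$ having exactly $d$ balls; write $w(\mathcal{B}_i)$ for the total weight of $\mathcal{B}_i$. The problem $\mathfrak{BP}(d,\underline{C};\underline{w})$ is feasible if some assignment has $w(\mathcal{B}_i)\leq C_i$ for all $i$, and $k$-feasible if some assignment has $w(\mathcal{B}_i)\leq C_i$ for all $i=k+1,\dots,n$ (capacities of bins $1,\dots,k$ may be exceeded). The constant $b(\lambda)$ for $\lambda=(\lambda_1\geq\cdots\geq\lambda_r\geq 0)$ of length $r$ (trailing zeros count): with conjugate $\lambda'_j=\#\{i:\lambda_i\geq j\}$ ($1\le j\le\lambda_1$), write $\lambda'=(r^{a_0},h_1^{a_1},\dots,h_k^{a_k})$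 ($c^a$ = $a$ entries equal to $c$), $a_0\geq0$, $a_1,\dots,a_k>0$, $r>h_1>\cdots>h_k>0$. If $k=0$, $b(\lambda)=0$; otherwise with $h_0=r$, $b(\lambda)=\sum_{t=1}^k(h_{t-1}-h_t)(a_t-1)+(h_k-1)(a_k-1)$. Here $b(\underline{w})$ is applied to $\lambda=(w_1,\dots,w_n)$, $r=n$. *)

(* Defs.v *)
From mathcomp Require Import all_boot all_order all_algebra.

Set Implicit Arguments.
Unset Strict Implicit.
Unset Printing Implicit Defensive.

Import Order.TTheory GRing.Theory Num.Theory.

Section Partitioning.

Variables n d : nat.

(* The ball (i, j) is the j-th of the d balls of weight w_i, and f sends each
   ball to its bin. Balls of equal weight are labelled, which changes neither
   the possible contents of the bins, as multisets, nor feasibility. *)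
Definition is_assignment (f : {ffun 'I_n * 'I_d -> 'I_n}) : Prop :=
  forall i : 'I_n, #|[set b : 'I_n * 'I_d | f b == i]| = d.

Definition bin_weight (w : n.-tuple nat) (f : {ffun 'I_n * 'I_d -> 'I_n})
    (i : 'I_n) : nat :=
  \sum_(b : 'I_n * 'I_d | f b == i) tnth w b.1.

Definition feasible (C : n.-tuple int) (w : n.-tuple nat) : Prop :=
  exists f : {ffun 'I_n * 'I_d -> 'I_n}, is_assignment f /\
    forall i : 'I_n, ((bin_weight w f i)%:Z <= tnth C i)%R.

(* Bins are indexed from 0, so that bins k+1, ..., n are the i with k <= i. *)
Definition k_feasible (k : nat) (C : n.-tuple int) (w : n.-tuple nat) : Prop :=
  exists f : {ffun 'I_n * 'I_d -> 'I_n}, is_assignment f /\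
    forall i : 'I_n, k <= i -> ((bin_weight w f i)%:Z <= tnth C i)%R.

End Partitioning.

(* A partition is a nonincreasing sequence s; its length r is size s, trailing
   zeros included. *)
Section PartitionConstant.

Variable s : seq nat.

Definition conj_part : seq nat :=
  [seq count (leq j) s | j <- iota 1 (head 0 s)].

(* conj_part is nonincreasing, so undup lists its distinct entries in
   decreasing order: this is [:: h_1; ...; h_k]. *)
Definition conj_heights : seq nat :=
  [seq h <- undup conj_part | h < size s].

(* h_0 = r, h_1, ..., h_k *)
Definition conj_height (t : nat) : nat := nth 0 (size s :: conj_heights) t.

Definition conj_mult (t : nat) : nat := count_mem (conj_height t) conj_part.

(* No subtraction truncates for nonincreasing s: r > h_1 > ... > h_k > 0, and
   a_t > 0 for 1 <= t <= k. *)
Definition b_const : nat :=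
  let k := size conj_heights in
  if k == 0 then 0 else
    \sum_(1 <= t < k.+1)
       (conj_height t.-1 - conj_height t) * (conj_mult t - 1)
    + (conj_height k - 1) * (conj_mult k - 1).

End PartitionConstant.

Definition d1_bound (n : nat) (w : seq nat) : nat :=
  n ^ 3 * head 0 w * (2 * n + head 0 w).

(* Main.v *)
Require Import Defs.
From mathcomp Require Import all_boot all_order all_algebra.
From mathcomp Require Import zify.

(** Number the bins so that i0 is the one whose capacity may be exceeded. Among
the assignments that respect the other capacities, take one minimizing the load
of i0, and suppose that i0 is still overfull; i0 then has the largest load. The
claim is that the slacks of the other bins sum to at most [b_const w].

Exchanges between two bins that keep both loads make bin i0 as rich in balls of
the maximal weight V as any other bin, up to a constant. Hall's theorem, applied
to the large entries of the bins-by-labels matrix of multiplicities, then gives a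
bijection sigma from bins to labels such that every bin holds many balls of its
own label and i0 owns the weight V. A bin whose slack is at least the gap between
its own weight and the next larger one can trade an own ball for a ball of the
bin owning that next weight. This passes slack to heavier owners, and never to
i0, by minimality; so in the end every owner of a weight below V has slack less
than the gap above its weight. A further exchange, modulo the gap g below V,
makes the slack of the other owners of V less than g. Since sigma is a bijection,
summing these bounds gives [b_const w]. *)

Set Implicit Arguments.
Unset Strict Implicit.
Unset Printing Implicit Defensive.

Lemma subset_of_card (T : finType) (A : {set T}) (k : nat) :
  k <= #|A| -> exists2 X : {set T}, X \subset A & #|X| = k.
Proof.
move=> le_kA; exists [set x in take k (enum A)].
  by apply/subsetP => x; rewrite inE => /mem_take; rewrite mem_enum.
rewrite cardsE (card_uniqP _) ?take_uniq ?enum_uniq // size_takel //.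
by rewrite -cardE.
Qed.

(** * Hall's marriage theorem *)

Section Hall.

Variables T U : finType.
Implicit Types (X A : {set T}) (r : T -> {set U}).

(** Induction on [#|X|]. A nonempty proper subset with no more neighbours than elements is matched
    first, and the rest outside its neighbourhood; if there is none, one element may take any
    neighbour. *)
Lemma hall_marriage (y0 : U) X r :
    (forall A, A \subset X -> #|A| <= #|\bigcup_(x in A) r x|) ->
  exists2 f : T -> U, {in X &, injective f} & {in X, forall x, f x \in r x}.
Proof.
have [m] := ubnP #|X|; elim: m => // m IHm in X r * => leXm hallX.
have [->|[x0 Xx0]] := set_0Vmem X.
  by exists (fun=> y0) => ? ; rewrite inE.
case: (boolP [exists A : {set T}, [&& A != set0, A \proper X &
          #|\bigcup_(x in A) r x| <= #|A|]]).
  case/existsP => A /and3P[A0 ltAX tightA].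
  have sAX := proper_sub ltAX; set N := \bigcup_(x in A) r x in tightA.
  have [|B sBA|f1 inj1 f1P] := IHm A r.
  - by have := proper_card ltAX; lia.
  - by apply: hallX; apply: subset_trans sAX.
  have [|B sB|f2 inj2 f2P] := IHm (X :\: A) (fun x => r x :\: N).
  - by have := cardsID A X; rewrite (setIidPr sAX) -card_gt0 in A0 *; lia.
  - have dAB : [disjoint A & B].
      rewrite disjoint_sym disjoints_subset (subset_trans sB) //.
      by apply/subsetP => x; rewrite !inE => /andP[].
    have := hallX (A :|: B); rewrite subUset sAX (subset_trans sB) ?subsetDl //.
    move=> /(_ isT); rewrite bigcup_setU -/N cardsU (disjoint_setI0 dAB) cards0.
    have -> : \bigcup_(x in B) (r x :\: N) = (\bigcup_(x in B) r x) :\: N.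
      apply/setP => y; rewrite !inE; apply/bigcupP/andP.
        case=> x Bx; rewrite inE => /andP[-> ry]; split=> //.
        by apply/bigcupP; exists x.
      by case=> Ny /bigcupP[x Bx ry]; exists x; rewrite // inE Ny.
    rewrite cardsU setIC cardsD.
    by have := subset_leq_card (subsetIl (\bigcup_(x in B) r x) N); lia.
  exists (fun x => if x \in A then f1 x else f2 x).
    have cross x y : x \in A -> y \in X -> y \notin A -> f1 x = f2 y -> False.
      move=> Ax Xy nAy e; have := f2P y; rewrite !inE nAy Xy -e => /(_ isT).
      by case/andP=> /bigcupP[]; exists x; rewrite ?f1P.
    move=> x y Xx Xy; case: ifPn => Ax; case: ifPn => Ay //.
    - exact: inj1.
    - by move/(cross _ _ Ax Xy Ay).
    - by move/esym/(cross _ _ Ay Xx Ax).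
    - by apply: inj2; rewrite inE ?Ax ?Ay.
  move=> x Xx; case: ifPn => Ax; first exact: f1P.
  by have := f2P x; rewrite !inE Ax Xx => /(_ isT) /andP[].
rewrite negb_exists => /forallP noA.
have [y ry] : exists y, y \in r x0.
  have := hallX [set x0]; rewrite sub1set big_set1 cards1 => /(_ Xx0).
  by rewrite card_gt0 => /set0Pn.
have [|B sB|f injf fP] := IHm (X :\ x0) (fun x => r x :\ y).
- by rewrite (cardsD1 x0 X) Xx0 in leXm; lia.
- have [->|B0] := eqVneq B set0; first by rewrite cards0.
  (* [B] is nonempty and proper in [X], so it has a neighbour to spare and can lose [y]. *)
  have := noA B; rewrite B0 (sub_proper_trans sB) ?properD1 //= -ltnNge.
  have -> : \bigcup_(x in B) (r x :\ y) = (\bigcup_(x in B) r x) :\ y.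
    apply/setP => z; rewrite !inE; apply/bigcupP/andP.
      by case=> x Bx; rewrite !inE => /andP[-> rz]; split=> //; apply/bigcupP; exists x.
    by case=> Nz /bigcupP[x Bx rz]; exists x; rewrite // !inE Nz.
  by rewrite (cardsD1 y (\bigcup_(x in B) r x)); lia.
have cross x : x \in X -> x != x0 -> f x = y -> False.
  by move=> Xx nx e; have := fP x; rewrite !inE nx Xx e eqxx => /(_ isT).
exists (fun x => if x == x0 then y else f x).
  move=> x z Xx Xz; case: (eqVneq x x0) => [->|nx]; case: (eqVneq z x0) => [->|nz] //.
  - by move/esym/(cross _ Xz nz).
  - by move/(cross _ Xx nx).
  - by apply: injf; rewrite !inE ?nx ?nz.
move=> x Xx; case: (eqVneq x x0) => [->//|nx].
by have := fP x; rewrite !inE nx Xx => /(_ isT) /andP[].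
Qed.

End Hall.

(** * Exchanges between two bins *)

Section Exchange.

Variables T I : finType.
Implicit Types (f : {ffun T -> I}) (g : T -> nat) (i j : I) (X Y : {set T}).

(** With [g] constant 1, an indicator or the weight, this is the size of a bin, a count of balls in
    it or its load, so one exchange lemma serves all three. *)
Definition stat g f i : nat := \sum_(b | f b == i) g b.

Definition bin f i : {set T} := [set b | f b == i].

Definition exchange f i j X Y : {ffun T -> I} :=
  [ffun b => if b \in X then j else if b \in Y then i else f b].

Lemma stat_exchangel g f i j X Y :
    i != j -> X \subset bin f i -> Y \subset bin f j ->
  stat g (exchange f i j X Y) i + \sum_(b in X) g b
    = stat g f i + \sum_(b in Y) g b.
Proof.
move=> ij /subsetP sX /subsetP sY.
have sumE (P : pred T) : \sum_(b | P b) g b = \sum_b P b * g b.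
  by rewrite big_mkcond; apply: eq_bigr => b _; case: (P b); rewrite ?mul1n.
rewrite /stat !sumE -!big_split; apply: eq_bigr => b _ /=; rewrite ffunE.
have := sX b; have := sY b; rewrite !inE.
case: (b \in X); case: (b \in Y) => sYb sXb //.
- by move/eqP: (sXb isT) (sYb isT) => ->; rewrite (negPf ij).
- by move/eqP: (sXb isT) => ->; rewrite eqxx eq_sym (negPf ij) addn0.
- by move/eqP: (sYb isT) => ->; rewrite eqxx eq_sym (negPf ij) addn0.
Qed.

Lemma stat_exchanger g f i j X Y :
    i != j -> X \subset bin f i -> Y \subset bin f j ->
  stat g (exchange f i j X Y) j + \sum_(b in Y) g b
    = stat g f j + \sum_(b in X) g b.
Proof.
move=> ij sX sY; rewrite eq_sym in ij.
rewrite -(stat_exchangel g ij sY sX); congr (_ + _); apply: eq_bigl => b.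
rewrite !ffunE; case: ifP => // Xb; case: ifP => // Yb.
move/subsetP/(_ _ Xb): sX; move/subsetP/(_ _ Yb): sY.
by rewrite !inE => /eqP-> /eqP e; rewrite e eqxx in ij.
Qed.

Lemma stat_exchange_other g f i j k X Y :
    k != i -> k != j -> X \subset bin f i -> Y \subset bin f j ->
  stat g (exchange f i j X Y) k = stat g f k.
Proof.
move=> ki kj /subsetP sX /subsetP sY; apply: eq_bigl => b; rewrite ffunE.
case: ifP => [/sX|_].
  by rewrite inE => /eqP->; rewrite eq_sym (negPf kj) eq_sym (negPf ki).
case: ifP => [/sY|//]; rewrite inE => /eqP->.
by rewrite eq_sym (negPf ki) eq_sym (negPf kj).
Qed.

Lemma stat_pred (P : pred T) f i : stat P f i = #|[set b in bin f i | P b]|.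
Proof.
rewrite -sum1_card [RHS](eq_bigl (fun b => (f b == i) && P b)).
  by rewrite big_mkcondr; apply: eq_bigr => b _; case: (P b).
by move=> b; rewrite !inE.
Qed.

Lemma stat_subset (P : pred T) f i k : k <= stat P f i ->
  exists X : {set T}, [/\ X \subset bin f i, {in X, forall b, P b} & #|X| = k].
Proof.
rewrite stat_pred => /subset_of_card[X /subsetP sX cX]; exists X; split=> //.
  by apply/subsetP => b /sX; rewrite inE => /andP[].
by move=> b /sX; rewrite inE => /andP[].
Qed.

Lemma sum_stat g f : \sum_i stat g f i = \sum_b g b.
Proof. by rewrite [RHS](partition_big f xpredT). Qed.

End Exchange.

Lemma sum_const_on (T : finType) (X : {set T}) (g : T -> nat) c :
  {in X, forall b, g b = c} -> \sum_(b in X) g b = #|X| * c.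
Proof. by move=> gX; rewrite (eq_bigr _ gX) sum_nat_const. Qed.

Lemma sum1_set (T : finType) (X : {set T}) : \sum_(b in X) 1 = #|X|.
Proof. exact: sum1_card. Qed.

Lemma sum_const_le (I : finType) (P : pred I) c : \sum_(i | P i) c <= #|I| * c.
Proof. by rewrite sum_nat_const leq_mul2r max_card orbT. Qed.

(** * Assignments minimizing the load of the overfull bin *)

Section MinimalOverload.

Variables (T I : finType) (lab : T -> I) (d : nat) (wgt : I -> nat) (V : nat).
Variables (K : I -> nat) (i0 : I) (mu : nat).

Implicit Types (f : {ffun T -> I}) (i j k l v : I) (X Y : {set T}).

Definition wt (b : T) : nat := wgt (lab b).

Definition load f k : nat := stat wt f k.

Definition valid f : bool :=
  [forall k, #|bin f k| == d] && [forall (j | j != i0), load f j <= K j].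

Definition opt f : bool := valid f && (load f i0 == mu).

Definition copies f k v : nat := stat (fun b : T => lab b == v) f k.

Definition weight_count (x : nat) f k : nat := stat (fun b => wt b == x) f k.

Lemma card_bin f k : valid f -> #|bin f k| = d.
Proof. by case/andP=> /forallP/(_ k)/eqP. Qed.

Lemma load_le f j : valid f -> j != i0 -> load f j <= K j.
Proof. by case/andP=> _ /forall_inP; apply. Qed.

Lemma load_i0 f : opt f -> load f i0 = mu.
Proof. by case/andP=> _ /eqP. Qed.

Lemma opt_valid f : opt f -> valid f.
Proof. by case/andP. Qed.

Lemma bin_stat f k : #|bin f k| = stat (fun=> 1) f k.
Proof. by rewrite -sum1_card /stat; apply: eq_bigl => b; rewrite inE. Qed.

Lemma valid_exchange f i j X Y :
    valid f -> i != j -> j != i0 -> X \subset bin f i -> Y \subset bin f j ->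
    #|X| = #|Y| ->
    load f j + \sum_(b in X) wt b <= K j + \sum_(b in Y) wt b ->
    (i != i0 -> load f i + \sum_(b in Y) wt b <= K i + \sum_(b in X) wt b) ->
  valid (exchange f i j X Y).
Proof.
move=> vf ij j0 sX sY cXY lej lei; apply/andP; split.
  apply/forallP => k; rewrite bin_stat; apply/eqP.
  have := card_bin _ vf; have [->|ki] := eqVneq k i.
    move/(_ i); have := stat_exchangel (fun=> 1) ij sX sY.
    by rewrite !sum1_set bin_stat; lia.
  have [->|kj] := eqVneq k j; last by rewrite stat_exchange_other // -bin_stat.
  move/(_ j); have := stat_exchanger (fun=> 1) ij sX sY.
  by rewrite !sum1_set bin_stat; lia.
apply/forall_inP => k k0; have [ki|ki] := eqVneq k i.
  have := stat_exchangel wt ij sX sY; rewrite ki in k0 *.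
  by have := lei k0; rewrite /load; lia.
have [->|kj] := eqVneq k j.
  by have := stat_exchanger wt ij sX sY; move: lej; rewrite /load; lia.
by rewrite /load stat_exchange_other // load_le.
Qed.

Lemma stat_label (G : I -> nat) f k :
  stat (fun b => G (lab b)) f k = \sum_v G v * copies f k v.
Proof.
rewrite /stat (partition_big (fun b : T => lab b) xpredT) //=.
apply: eq_bigr => v _; rewrite /copies /stat big_distrr /=.
rewrite big_mkcondr; apply: eq_bigr => b _.
by case: eqVneq => [->|_]; rewrite ?muln1 ?muln0.
Qed.

Hypothesis lab_card : forall v, #|[set b | lab b == v]| = d.
Hypothesis wgt_le : forall i, wgt i <= V.
Hypothesis mu_min : forall f, valid f -> mu <= load f i0.
Hypothesis mu_gt : forall j, j != i0 -> K j < mu.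

Lemma opt_exchange f i j X Y :
    opt f -> i != j -> j != i0 -> X \subset bin f i -> Y \subset bin f j ->
    #|X| = #|Y| ->
    load f j + \sum_(b in X) wt b <= K j + \sum_(b in Y) wt b ->
    (if i == i0 then \sum_(b in X) wt b = \sum_(b in Y) wt b
     else load f i + \sum_(b in Y) wt b <= K i + \sum_(b in X) wt b) ->
  opt (exchange f i j X Y).
Proof.
move=> of_ ij j0 sX sY cXY lej lei; apply/andP; split.
  apply: valid_exchange => //; first exact: opt_valid.
  by move=> i_n0; rewrite (negPf i_n0) in lei.
apply/eqP; have := load_i0 of_; have [e|ne] := eqVneq i i0.
  have := stat_exchangel wt ij sX sY; rewrite e eqxx in lei *.
  by rewrite /load; lia.
by rewrite /load stat_exchange_other // eq_sym.
Qed.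

(** Otherwise the exchange would respect the capacity of [j] and lower the load of [i0] below the
    minimum [mu]. *)
Lemma no_gain f j X Y :
    opt f -> j != i0 -> X \subset bin f i0 -> Y \subset bin f j ->
    #|X| = #|Y| -> \sum_(b in Y) wt b < \sum_(b in X) wt b ->
  K j + \sum_(b in Y) wt b < load f j + \sum_(b in X) wt b.
Proof.
move=> of_ j0 sX sY cXY ltYX; rewrite ltnNge; apply/negP => le.
have i0j : i0 != j by rewrite eq_sym.
have v' : valid (exchange f i0 j X Y).
  by apply: valid_exchange; rewrite ?opt_valid ?eqxx.
have := mu_min v'; have := stat_exchangel wt i0j sX sY.
by have := load_i0 of_; rewrite /load; lia.
Qed.

Lemma no_gain1 f j x y :
    opt f -> j != i0 -> f x = i0 -> f y = j -> wt y < wt x ->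
  K j + wt y < load f j + wt x.
Proof.
move=> of_ j0 fx fy ltyx.
have := @no_gain f j [set x] [set y] of_ j0; rewrite !sub1set !inE fx fy !eqxx.
by rewrite !cards1 !big_set1 => /(_ isT isT erefl ltyx).
Qed.

Lemma sum_copies_label f v : \sum_k copies f k v = d.
Proof.
rewrite /copies sum_stat -(lab_card v) -sum1_card [RHS]big_mkcond.
by apply: eq_bigr => b _; rewrite inE; case: eqP.
Qed.

Lemma sum_load f : \sum_k load f k = d * \sum_i wgt i.
Proof.
rewrite big_distrr /= (eq_bigr _ (fun k _ => stat_label wgt f k)) exchange_big.
by apply: eq_bigr => v _; rewrite -big_distrr /= sum_copies_label mulnC.
Qed.

Lemma sum_copies_bin f k : valid f -> \sum_v copies f k v = d.
Proof.
move=> vf; rewrite -(card_bin k vf) bin_stat (stat_label (fun=> 1)).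
by apply: eq_bigr => v _; rewrite mul1n.
Qed.

(** * Balls of maximal weight in the overfull bin *)

Lemma weight_count_label x f k :
  weight_count x f k = \sum_(v | wgt v == x) copies f k v.
Proof.
rewrite /weight_count (stat_label (fun v => wgt v == x)) [RHS]big_mkcond.
by apply: eq_bigr => v _; case: eqP; rewrite ?mul1n.
Qed.

Lemma weight_count_max f k : valid f ->
  weight_count V f k + \sum_(v | wgt v < V) copies f k v = d.
Proof.
move=> vf; rewrite weight_count_label -(sum_copies_bin k vf).
rewrite [RHS](bigID (fun v => wgt v == V)) /=; congr (_ + _).
by apply: eq_bigl => v; rewrite ltn_neqAle wgt_le andbT.
Qed.

Lemma load_deficiency f k : valid f ->
  load f k + \sum_(v | wgt v < V) (V - wgt v) * copies f k v = d * V.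
Proof.
move=> vf; rewrite /load (stat_label wgt) -(sum_copies_bin k vf) big_distrl /=.
rewrite [\sum_(v | wgt v < V) _]big_mkcond -big_split /=; apply: eq_bigr => v _.
by have := wgt_le v; case: ltnP => ? ?; nia.
Qed.

(* The exchange takes from bin i0 balls of label v, and gives back lighter and
   maximal ones in the proportions that keep both weights. *)
Lemma rich_zero_sum f j v v' :
    opt f -> (forall f', opt f' -> weight_count V f' i0 <= weight_count V f i0) ->
    j != i0 -> wgt v < V -> wgt v' < V -> V <= copies f i0 v ->
    V <= copies f j v' -> V <= weight_count V f j ->
  wgt v <= wgt v'.
Proof.
move=> of_ maxf j0 vV v'V cv cv' cV; rewrite leqNgt; apply/negP => v'v.
have [X [sX X_v cX]] := stat_subset (leq_trans (leq_subr (wgt v') V) cv).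
have le1 : wgt v - wgt v' <= weight_count V f j by lia.
have [Y1 [sY1 Y1_V cY1]] := stat_subset le1.
have [Y2 [sY2 Y2_v cY2]] := stat_subset (leq_trans (leq_subr (wgt v) V) cv').
have dY : [disjoint Y1 & Y2].
  rewrite disjoint_subset; apply/subsetP => b /Y1_V/eqP bV.
  by apply/negP => /Y2_v/eqP bv; move: bV; rewrite /wt bv; lia.
have sum_Y (g : T -> nat) : \sum_(b in Y1 :|: Y2) g b
    = \sum_(b in Y1) g b + \sum_(b in Y2) g b.
  by rewrite -bigU //=; apply: eq_bigl => b; rewrite inE.
have sumX : \sum_(b in X) wt b = (V - wgt v') * wgt v.
  by rewrite -cX; apply: sum_const_on => b /X_v/eqP; rewrite /wt => ->.
have sumY : \sum_(b in Y1 :|: Y2) wt b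
    = (wgt v - wgt v') * V + (V - wgt v) * wgt v'.
  rewrite sum_Y -cY1 -cY2; congr (_ + _); apply: sum_const_on => b.
    by move/Y1_V/eqP.
  by move/Y2_v/eqP; rewrite /wt => ->.
have cXY : #|X| = #|Y1 :|: Y2|.
  by rewrite cardsU disjoint_setI0 // cards0 cX cY1 cY2; lia.
have eXY : \sum_(b in X) wt b = \sum_(b in Y1 :|: Y2) wt b.
  by rewrite sumX sumY; nia.
have sY : Y1 :|: Y2 \subset bin f j by rewrite subUset sY1.
have i0j : i0 != j by rewrite eq_sym.
have o' : opt (exchange f i0 j X (Y1 :|: Y2)).
  apply: opt_exchange; rewrite ?eqxx // eXY leq_add2r.
  by rewrite load_le ?opt_valid.
have := maxf _ o'; have := stat_exchangel (fun b => wt b == V) i0j sX sY.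
rewrite /weight_count sum_Y.
rewrite (@sum_const_on _ X _ 0); last first.
  by move=> b /X_v/eqP e; rewrite /wt e; case: eqP => //; lia.
rewrite (@sum_const_on _ Y1 _ 1); last by move=> b /Y1_V ->.
by lia.
Qed.

(** An optimal assignment with the most maximal balls in [i0] works. If a bin [j] had far more of
    them, then by [rich_zero_sum] its light balls would be, with few exceptions, no lighter than
    those of [i0], so [j] would have the larger load. *)
Lemma exists_rich f0 : opt f0 -> 0 < V ->
  exists2 f, opt f &
    forall j, weight_count V f j <= weight_count V f i0 + #|I| * V ^ 2.
Proof.
move=> of0 V0.
case: (arg_maxnP (fun f => weight_count V f i0) of0) => f of_ maxf.
exists f => // j; have [->|j0] := eqVneq j i0; first by rewrite leq_addr.
rewrite leqNgt; apply/negP => ltM.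
have vf := opt_valid of_.
have n0 : 0 < #|I| by apply/card_gt0P; exists i0.
have cV : V <= weight_count V f j by nia.
have zs v v' : wgt v < V -> wgt v' < V -> V <= copies f i0 v ->
    V <= copies f j v' -> wgt v <= wgt v'.
  by move=> *; apply: (rich_zero_sum of_ maxf j0).
have ltW : load f j < load f i0.
  by rewrite (load_i0 of_); apply: leq_ltn_trans (mu_gt j0); apply: load_le.
have M0 := weight_count_max i0 vf; have Mj := weight_count_max j vf.
have D0 := load_deficiency i0 vf; have Dj := load_deficiency j vf.
case: (pickP (fun v => (wgt v < V) && (V <= copies f i0 v))) => [v1 hv1|none].
  (* [v] is the heaviest light label plentiful in [i0]: balls of plentiful light labels lack at
     least [D] each in [i0], at most [D] each in [j]. A label with fewer than [V] copies costs an
     error of at most [D * (V - 1)] or [(V - D) * (V - 1)]. *)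
  pose P v := (wgt v < V) && (V <= copies f i0 v).
  have [v /andP[vV cv] maxv] := @arg_maxnP _ v1 P wgt hv1.
  set D := V - wgt v.
  have lo : D * \sum_(u | wgt u < V) copies f i0 u
      <= \sum_(u | wgt u < V) (V - wgt u) * copies f i0 u + #|I| * (D * (V - 1)).
    apply: (@leq_trans (\sum_(u | wgt u < V) ((V - wgt u) * copies f i0 u + D * (V - 1)))).
      rewrite big_distrr /=; apply: leq_sum => u uV.
      have [cu|cu] := leqP V (copies f i0 u); last by nia.
      by have := maxv u; rewrite /P uV cu => /(_ isT); rewrite /D; nia.
    by rewrite big_split /= leq_add2l sum_const_le.
  have hi : \sum_(u | wgt u < V) (V - wgt u) * copies f j u
      <= D * (\sum_(u | wgt u < V) copies f j u) + #|I| * ((V - D) * (V - 1)).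
    apply: (@leq_trans (\sum_(u | wgt u < V) (D * copies f j u + (V - D) * (V - 1)))).
      apply: leq_sum => u uV.
      have [cu|cu] := leqP V (copies f j u).
        by have := zs _ _ vV uV cv cu; rewrite /D; nia.
      by rewrite /D; nia.
    by rewrite big_split /= -big_distrr /= leq_add2l sum_const_le.
  move: lo hi M0 Mj D0 Dj.
  set a0 := \sum_(_ | _) _; set b0 := \sum_(_ | _) _.
  set bj := \sum_(_ | _) _; set aj := \sum_(_ | _) _ => lo hi M0 Mj D0 Dj.
  have D_gt0 : 0 < D by rewrite /D subn_gt0.
  have D_le : D <= V by rewrite /D leq_subr.
  have lt1 : b0 < bj by lia.
  have e1 : #|I| * (D * (V - 1)) + #|I| * ((V - D) * (V - 1))
      = #|I| * (V * (V - 1)).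
    by rewrite -mulnDr -mulnDl subnKC.
  have lt2 : D * a0 < D * aj + #|I| * (V * (V - 1)) by lia.
  have lt3 : a0 > aj + #|I| * V ^ 2 by lia.
  have := leq_mul (leqnn D) (ltnW lt3); rewrite mulnDr.
  have : #|I| * (V * (V - 1)) <= D * (#|I| * V ^ 2).
    by rewrite (leq_trans _ (leq_pmull _ D_gt0)) // leq_mul2l expnS leq_mul2l; lia.
  by lia.
have le1 : \sum_(u | wgt u < V) copies f i0 u <= \sum_(u | wgt u < V) V.
  by apply: leq_sum => u uV; have := none u; rewrite uV /=; lia.
have := leq_trans le1 (sum_const_le _ V).
have : #|I| * V <= #|I| * V ^ 2 by nia.
by lia.
Qed.

(** Double counting: the [h] labels of weight [V] have [h * d] balls, no bin holds over
    [#|I| * V ^ 2] more of them than [i0], and in [i0] the commonest label makes up at least a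
    fraction [1 / h]. *)
Lemma exists_rich_label f vmax : valid f -> wgt vmax = V ->
    (forall j, weight_count V f j <= weight_count V f i0 + #|I| * V ^ 2) ->
  exists2 v, wgt v = V & d <= #|I| * (copies f i0 v + #|I| * V ^ 2).
Proof.
move=> vf /eqP maxV rich.
have [v /eqP vV maxv] := @arg_maxnP _ vmax (fun v => wgt v == V) (copies f i0) maxV.
exists v => //; set h := #|[pred v | wgt v == V]|.
have h_gt0 : 0 < h by apply/card_gt0P; exists vmax.
have sumM : \sum_j weight_count V f j = h * d.
  rewrite (eq_bigr _ (fun j _ => weight_count_label V f j)) exchange_big /=.
  by rewrite (eq_bigr _ (fun v _ => sum_copies_label f v)) sum_nat_const.
have leM0 : weight_count V f i0 <= h * copies f i0 v.
  rewrite weight_count_label -sum_nat_const; exact: leq_sum.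
have : h * d <= #|I| * (weight_count V f i0 + #|I| * V ^ 2).
  by rewrite -sumM -sum_nat_const; apply: leq_sum => j _.
move=> le; rewrite -(leq_pmul2l h_gt0) (leq_trans le) // mulnCA leq_mul2l.
by rewrite mulnDr leq_add ?orbT // leq_pmull.
Qed.

(** * Assigning an owned label to each bin *)

(** Here [a] bins have only [b] plentiful labels. If [a = b + 1], then [c] is at most
    [(n - a) * a * tau], hence at most [tau * n ^ 2 / 4] by the AM-GM inequality; otherwise [e] is
    at most [tau * n ^ 2]. *)
Lemma hall_count_bound (n a b c tau e : nat) :
    a < n -> b < a -> e * a + c <= e * b.+1 + (n.-1 - b) * (a * tau.-1) ->
    tau * n ^ 2 < 4 * c -> tau * n ^ 2 < e -> False.
Proof.
move=> an ba le ltc lte; have [e_ab|ab] := eqVneq a b.+1.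
  rewrite e_ab in an le.
  have {}le : c <= (n.-1 - b) * (b.+1 * tau.-1) by lia.
  have := leq_mul (leqnn 4) le; have : 4 * ((n.-1 - b) * b.+1) <= n ^ 2.
    rewrite (leq_trans (nat_AGM2 _ _)) // (_ : _ + _ = n) //; lia.
  move=> le2; have := leq_mul le2 (leq_pred tau).
  rewrite -!mulnA; have -> : n * (n * tau) = tau * n ^ 2 by rewrite mulnA mulnC mulnn.
  by lia.
have : e * b.+2 <= e * a by rewrite leq_mul2l; lia.
have : (n.-1 - b) * (a * tau.-1) <= n * (n * tau).
  by rewrite leq_mul ?leq_mul //; lia.
have -> : n * (n * tau) = tau * n ^ 2 by rewrite mulnA mulnC mulnn.
by lia.
Qed.

(** Hall's theorem is applied to the bins other than [i0] and the labels other than [v]. A violating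
    set of bins is refuted by counting its balls: label [v] supplies at most [d] minus its copies in
    [i0], a neighbour at most [d], any other label fewer than [tau] per bin. *)
Lemma exists_owner f v tau : valid f -> 1 < #|I| ->
    tau * #|I| ^ 2 < 4 * copies f i0 v -> tau * #|I| ^ 2 < d ->
  exists sigma : I -> I,
    [/\ injective sigma, sigma i0 = v & forall j, tau <= copies f j (sigma j)].
Proof.
move=> vf n_gt1 ltc ltd; pose r k := [set u | (u != v) && (tau <= copies f k u)].
have [A sA|g injg gP] := @hall_marriage _ _ v [set~ i0] r.
  set N := \bigcup_(x in A) r x; rewrite leqNgt; apply/negP => ltNA.
  have Ai0 : i0 \notin A by apply/negP => /(subsetP sA); rewrite !inE eqxx.
  have Nv : v \notin N by apply/bigcupP => -[k _]; rewrite inE eqxx.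
  have ltAn : #|A| < #|I|.
    by have := subset_leq_card sA; rewrite cardsC1; lia.
  apply: (@hall_count_bound #|I| #|A| #|N| _ tau d ltAn ltNA _ ltc ltd).
  pose S u := \sum_(k in A) copies f k u.
  have sumA : d * #|A| = \sum_u S u.
    rewrite exchange_big /= mulnC -sum_nat_const.
    by apply: eq_bigr => k _; rewrite sum_copies_bin.
  rewrite sumA (bigD1 v) //= (bigID (fun u => u \in N) (fun u => u != v)) /=.
  have le1 : S v + copies f i0 v <= d.
    rewrite -(sum_copies_label f v) [leqRHS](bigID (fun k => k \in A)) /=.
    by rewrite leq_add2l (bigD1 i0) //= leq_addr.
  have le2 : \sum_(u | (u != v) && (u \in N)) S u <= d * #|N|.
    rewrite (eq_bigl (fun u => u \in N)); last first.
      by move=> u /=; case: eqVneq => // ->; rewrite (negPf Nv).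
    rewrite mulnC -sum_nat_const; apply: leq_sum => u _.
    by rewrite -(sum_copies_label f u) [leqRHS](bigID (fun k => k \in A)) /= leq_addr.
  have le3 : \sum_(u | (u != v) && (u \notin N)) S u
      <= (#|I|.-1 - #|N|) * (#|A| * tau.-1).
    have <- : #|[pred u | (u != v) && (u \notin N)]| = #|I|.-1 - #|N|.
      have <- : #|~: (v |: N)| = #|I|.-1 - #|N|.
        by have := cardsC (v |: N); rewrite cardsU1 Nv; lia.
      by apply: eq_card => u; rewrite !inE negb_or.
    rewrite -[leqRHS]sum_nat_const; apply: leq_sum => u /andP[uv uN].
    rewrite -sum_nat_const; apply: leq_sum => k kA.
    have : ~~ (tau <= copies f k u).
      by apply: contra uN => le; apply/bigcupP; exists k; rewrite // inE uv.
    by lia.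
  rewrite mulnS (leq_trans _ (leq_add (leq_add le1 le2) le3)) //.
  by rewrite -!addnA leq_add2l addnA addnC addnA.
exists (fun k => if k == i0 then v else g k).
have gA k : k != i0 -> g k != v /\ tau <= copies f k (g k).
  by move=> k0; have := gP k; rewrite !inE => /(_ k0) /andP.
split; rewrite ?eqxx //.
  move=> x y; case: eqVneq => [->|nx]; case: eqVneq => [->|ny] //.
  - by move=> e; case: (gA _ ny); rewrite -e eqxx.
  - by move=> e; case: (gA _ nx); rewrite e eqxx.
  - by apply: injg; rewrite !inE.
move=> j; case: eqVneq => [->|/gA[]//].
by nia.
Qed.

(** A bin of maximal balls alone would have load [d * V], which is no less than [mu]. *)
Lemma exists_light_ball f j : opt f -> j != i0 ->
  exists2 y, f y = j & wt y < V.
Proof.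
move=> of_ j0; have vf := opt_valid of_.
case: (pickP [pred y in bin f j | wt y < V]) => [y|noy].
  by rewrite !inE => /andP[/eqP fy ltV]; exists y.
have le0 : load f i0 <= d * V.
  by rewrite -(load_deficiency i0 vf) leq_addr.
have : d * V <= load f j.
  rewrite -(card_bin j vf) -sum_nat_const /load /stat.
  rewrite [leqRHS](eq_bigl (mem (bin f j))) => [|b]; last by rewrite !inE.
  by apply: leq_sum => b fb; have := noy b; rewrite inE /= fb /= ltnNge => /negbFE.
have := load_i0 of_; have := mu_gt j0; have := load_le vf j0; lia.
Qed.

Definition slack f k : nat := K k - load f k.

Lemma slackK f k : opt f -> k != i0 -> load f k + slack f k = K k.
Proof. by move=> /opt_valid vf k0; rewrite /slack subnKC ?load_le. Qed.

Lemma weight_count_gt0 x f k : 0 < weight_count x f k ->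
  exists2 b, f b = k & wt b = x.
Proof.
rewrite /weight_count stat_pred => /card_gt0P[b].
by rewrite !inE => /andP[/eqP ? /eqP ?]; exists b.
Qed.

(** * Passing slack to heavier owners *)

Section Owners.

Variables (vmax : I) (sigma : I -> I).
Hypotheses (wgt_vmax : wgt vmax = V) (sigma_inj : injective sigma).
Hypothesis sigma_i0 : wgt (sigma i0) = V.

Let u k : nat := wgt (sigma k).

Definition next_weight x : nat := wgt [arg min_(i < vmax | x < wgt i) wgt i].

Definition second_weight : nat := \max_(i | wgt i < V) wgt i.

(** A light owner passes slack upwards, so its bound is the gap above its weight; for an owner of
    [V] there is only the gap below. *)
Definition gap x : nat := if x < V then next_weight x - x else V - second_weight.

Lemma next_weight_gt x : x < V -> x < next_weight x.
Proof.
move=> xV; rewrite /next_weight.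
by case: arg_minnP => [|i //]; rewrite wgt_vmax.
Qed.

Lemma next_weight_le x i : x < wgt i -> next_weight x <= wgt i.
Proof.
move=> xi; rewrite /next_weight; case: arg_minnP => [|k _]; last exact.
by rewrite wgt_vmax (leq_trans xi).
Qed.

Lemma owner_of v : exists j, u j = wgt v.
Proof.
have [g _ gK] := injF_bij sigma_inj.
by exists (g v); rewrite /u gK.
Qed.

Definition own f k : nat := weight_count (u k) f k.

Definition wslack f (h : I -> nat) : nat := \sum_(k | k != i0) slack f k * h k.

Lemma wslack_transfer f f' (h : I -> nat) j l g :
    j != i0 -> l != i0 -> j != l ->
    slack f' j + g = slack f j -> slack f' l = slack f l + g ->
    (forall k, k != j -> k != l -> slack f' k = slack f k) ->
  wslack f' h + g * h j = wslack f h + g * h l.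
Proof.
move=> j0 l0 jl ej el e; rewrite /wslack.
have jl' : (l != i0) && (l != j) by rewrite l0 eq_sym.
rewrite 2!(bigD1 j j0) 2!(bigD1 l jl') /= -ej el.
rewrite (eq_bigr (fun k => slack f k * h k)); first by lia.
by move=> k /andP[/andP[_ kj] kl]; rewrite e.
Qed.

(* The number of own balls of a bin decreases each time slack passes from a
   bin owning less to it, or from it to a bin owning more; this budget
   decreases at least as fast. *)
Definition budget k i : nat := (u i <= u k) + (u i < u k).

Definition pushable (L : nat) f : bool :=
  opt f && [forall k, wslack f (budget k) + L <= own f k].

Definition potential f : nat := wslack f (fun k => V - u k).

(** With larger slack, [j] could trade an own ball for one of the owner [l] of the next weight; the
    slack passed to [l] counts less in [potential]. *)
Lemma push_minimal L f j : 0 < L ->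
    pushable L f -> (forall f', pushable L f' -> potential f <= potential f') ->
    j != i0 -> u j < V ->
  slack f j < next_weight (u j) - u j.
Proof.
move=> L_gt0 /andP[of_ /forallP own_ge] minf j0 ujV; rewrite ltnNge; apply/negP => sj.
have [l ul] := owner_of [arg min_(i < vmax | u j < wgt i) wgt i].
rewrite -/(next_weight (u j)) in ul.
have uj_lt : u j < u l by rewrite ul next_weight_gt.
have own_gt0 k : 0 < own f k by have := own_ge k; lia.
have [x fx wx] := weight_count_gt0 (own_gt0 l).
have [y fy wy] := weight_count_gt0 (own_gt0 j).
rewrite -ul in sj.
have [l_i0|l0] := eqVneq l i0.
  have := no_gain1 of_ j0 (etrans fx l_i0) fy; rewrite wx wy => /(_ uj_lt).
  by have := slackK of_ j0; lia.
have lj : l != j by apply: contraTneq uj_lt => ->; rewrite ltnn.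
have sx : [set x] \subset bin f l by rewrite sub1set inE fx.
have sy : [set y] \subset bin f j by rewrite sub1set inE fy.
set f' := exchange f l j [set x] [set y].
have sKj := slackK of_ j0; have sKl := slackK of_ l0.
have of' : opt f'.
  apply: opt_exchange; rewrite ?cards1 ?big_set1 ?wx ?wy ?(negPf l0) //; lia.
have ej : slack f' j + (u l - u j) = slack f j.
  have := stat_exchanger wt lj sx sy; rewrite !big_set1 wx wy.
  by have := slackK of' j0; rewrite -/f' -/(load f' j) -/(load f j); lia.
have el : slack f' l = slack f l + (u l - u j).
  have := stat_exchangel wt lj sx sy; rewrite !big_set1 wx wy.
  by have := slackK of' l0; rewrite -/f' -/(load f' l) -/(load f l); lia.
have e k : k != j -> k != l -> slack f' k = slack f k.
  by move=> kj kl; rewrite /slack /load stat_exchange_other.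
have jl : j != l by rewrite eq_sym.
have transf h := wslack_transfer h j0 l0 jl ej el e.
have pf' : pushable L f'.
  rewrite /pushable of'; apply/forallP => k.
  have := own_ge k; have := transf (budget k); rewrite /budget.
  (* In the budget of [j] the coefficient of the moved slack drops from 1 to 0, in that of [l] from
     2 to 1, which pays for the own ball given away. In other budgets it does not grow, being
     nonincreasing in the owned weight. *)
  have [->|kj] := eqVneq k j.
    have := stat_exchanger (fun b => wt b == u j) lj sx sy.
    rewrite /own /weight_count -/f' !big_set1 wy eqxx leqnn ltnn.
    have [-> ->] : (u l <= u j) = false /\ (u l < u j) = false by clear -uj_lt; lia.
    by clear -uj_lt; lia.
  have [->|kl] := eqVneq k l.
    have := stat_exchangel (fun b => wt b == u l) lj sx sy.
    rewrite /own /weight_count -/f' !big_set1 wx eqxx leqnn ltnn.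
    have [-> ->] : (u j <= u l) = true /\ (u j < u l) = true by clear -uj_lt; lia.
    by clear -uj_lt; lia.
  rewrite /own /weight_count stat_exchange_other //.
  have le : (u l <= u k) + (u l < u k) <= (u j <= u k) + (u j < u k).
    by clear -uj_lt; lia.
  by have := leq_mul (leqnn (u l - u j)) le; clear; lia.
have := minf _ pf'; have := transf (fun k => V - u k).
rewrite -/(potential f) -/(potential f').
have ulV : u l <= V by apply: wgt_le.
have : (u l - u j) * (V - u l) < (u l - u j) * (V - u j).
  by rewrite ltn_mul2l; clear -uj_lt ulV; lia.
by clear; lia.
Qed.

(** Otherwise a light ball of [j] could be traded for a maximal ball of [i0]. *)
Lemma slack_lt f j : opt f -> 0 < own f i0 -> j != i0 -> slack f j < V.
Proof.
move=> of_ own0 j0; have [y fy wy] := exists_light_ball of_ j0.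
have [x fx wx] := weight_count_gt0 own0.
have := no_gain1 of_ j0 fx fy; rewrite wx [u i0]sigma_i0 => /(_ wy).
by have := slackK of_ j0; lia.
Qed.

(** A minimizer of [potential] is taken. The initial budget is at most [2 * (V - 1)] per bin, so
    [#|I| * V + 1] own balls survive: a reserve of [V] for each bin that may have to be unstuck,
    plus one. *)
Lemma exists_pushed f : opt f -> 0 < V ->
    (forall k, 3 * #|I| * V <= own f k) ->
  exists f', [/\ opt f', forall k, #|I| * V + 1 <= own f' k &
    forall j, j != i0 -> u j < V -> slack f' j < next_weight (u j) - u j].
Proof.
move=> of_ V0 own_ge; set L := #|I| * V + 1.
have n_gt0 : 0 < #|I| by apply/card_gt0P; exists i0.
have L0 : 0 < L by rewrite /L addn1.
have own0 : 0 < own f i0 by apply: leq_trans (own_ge i0); rewrite !muln_gt0 n_gt0.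
have pf : pushable L f.
  rewrite /pushable of_; apply/forallP => k.
  have : wslack f (budget k) <= #|I| * (V.-1 * 2).
    rewrite /wslack (leq_trans _ (sum_const_le (fun k => k != i0) _)) //.
    apply: leq_sum => i i_n0; apply: leq_mul.
      by have := slack_lt of_ own0 i_n0; lia.
    exact: leq_add (leq_b1 _) (leq_b1 _).
  by have := own_ge k; rewrite /L; nia.
case: (arg_minnP potential pf) => f' pf' minf'.
exists f'; split.
- by case/andP: pf'.
- by move=> k; case/andP: pf' => _ /forallP/(_ k); lia.
- by move=> j j0 ujV; apply: (push_minimal L0 pf').
Qed.

Lemma second_weight_lt : 0 < V -> second_weight < V.
Proof.
move=> V0; suff : second_weight <= V.-1 by clear -V0; lia.
by apply/bigmax_leqP => i; clear; lia.
Qed.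

(** * Reducing the slack of the owners of the maximal weight *)

Definition top_gap : nat := V - second_weight.

Definition stuck f : pred I :=
  [pred j | [&& j != i0, u j == V & top_gap <= slack f j]].

(** The invariant of unsticking: bin [l] reserves [V] own balls for each stuck bin, and one more
    that it keeps. *)
Definition topped l f : Prop :=
  [/\ opt f, 0 < own f i0, #|stuck f| * V + 1 <= own f l,
      forall j, stuck f j -> V <= own f j &
      forall j, j != i0 -> u j < V -> slack f j < gap (u j)].

(* A stuck bin j owns V but holds a ball of weight y < V. Trading y and c balls
   of weight V for c + 1 second-heaviest balls of bin l changes its load by
   (second_weight - y) - c * top_gap, which is a remainder modulo top_gap for
   the right c. If afterwards the slack of bin j or l is at least top_gap, a
   second-heaviest ball can be traded for one of weight V of bin i0. *)
Lemma unstick l f j : topped l f -> l != i0 -> u l = second_weight ->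
  stuck f j -> exists2 f', topped l f' & #|stuck f'| < #|stuck f|.
Proof.
move=> [of_ own0 ownl owns gaps] l0 ul stj.
have /and3P[j0 /eqP uj sj] := stj; have ownj := owns j stj.
have [y fy wy] := exists_light_ball of_ j0.
have g_gt0 : 0 < top_gap by rewrite subn_gt0 second_weight_lt // (leq_ltn_trans _ wy).
have ul_lt : u l < V by rewrite ul -subn_gt0.
have wy_le : wt y <= second_weight by apply: (leq_bigmax_cond (lab y)).
have lj : l != j by apply: contraTneq ul_lt => ->; rewrite uj ltnn.
set c := (second_weight - wt y) %/ top_gap.
set r := (second_weight - wt y) %% top_gap.
have divE : second_weight - wt y = c * top_gap + r by apply: divn_eq.
have r_lt : r < top_gap by rewrite ltn_mod.
have c_lt : c < V.
  by have := leq_pmulr c g_gt0; rewrite ul in ul_lt; lia.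
have stuck_gt0 : 0 < #|stuck f| by apply/card_gt0P; exists j.
have c1_lt : c.+1 < own f l.
  rewrite (leq_trans _ ownl) // addn1 ltnS (leq_trans c_lt) //.
  exact: leq_pmull stuck_gt0.
have [X [sX Xw cX]] := stat_subset (ltnW c1_lt).
have [Y1 [sY1 Y1w cY1]] := stat_subset (leq_trans (ltnW c_lt) ownj).
rewrite /= ul in Xw; rewrite /= uj in Y1w.
have yY1 : y \notin Y1 by apply/negP => /Y1w/eqP; lia.
set Y := y |: Y1.
have sY : Y \subset bin f j by rewrite subUset sub1set inE fy eqxx.
have cXY : #|X| = #|Y| by rewrite cardsU1 yY1 cX cY1.
have sumX : \sum_(b in X) wt b = c.+1 * second_weight.
  by rewrite -cX; apply: sum_const_on => b /Xw/eqP.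
have sumY : \sum_(b in Y) wt b = wt y + c * V.
  rewrite big_setU1 //= -cY1; congr (_ + _).
  by apply: sum_const_on => b /Y1w/eqP.
have sumXY : \sum_(b in X) wt b = \sum_(b in Y) wt b + r.
  have : c * V = c * second_weight + c * top_gap.
    by rewrite -mulnDr subnKC // ltnW // -ul.
  by rewrite sumX sumY mulSn; clear -divE wy_le; lia.
set f' := exchange f l j X Y.
have sKj := slackK of_ j0; have sKl := slackK of_ l0.
have of' : opt f'.
  apply: opt_exchange; rewrite ?(negPf l0) //; first by clear -sKj sumXY r_lt sj; lia.
  by clear -sKl sumXY; lia.
have ej : slack f' j + r = slack f j.
  have := stat_exchanger wt lj sX sY; have := slackK of' j0.
  rewrite -/f' -/(load f' j) -/(load f j); clear -sKj sumXY r_lt sj; lia.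
have el : slack f' l = slack f l + r.
  have := stat_exchangel wt lj sX sY; have := slackK of' l0.
  rewrite -/f' -/(load f' l) -/(load f l); clear -sKl sumXY; lia.
have e k : k != j -> k != l -> slack f' k = slack f k.
  by move=> kj kl; rewrite /slack /load stat_exchange_other.
have owno k : k != j -> k != l -> own f' k = own f k.
  by move=> kj kl; rewrite /own /weight_count stat_exchange_other.
have own0' : 0 < own f' i0 by rewrite owno // eq_sym.
have ownl' : own f l <= own f' l + V.
  have := stat_exchangel (fun b => wt b == u l) lj sX sY.
  rewrite -/f' -/(weight_count (u l) f' l) -/(weight_count (u l) f l).
  rewrite -/(own f' l) -/(own f l) (@sum_const_on _ X _ 1).
    by clear -cX c_lt; lia.
  by move=> b /Xw; rewrite ul => ->.
have [z fz wz] := weight_count_gt0 own0'; rewrite [u i0]sigma_i0 in wz.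
have no_top k x : k != i0 -> f' x = k -> wt x = second_weight ->
    slack f' k < top_gap.
  move=> k0 fx wx; have := no_gain1 of' k0 fz fx; rewrite wz wx -ul => /(_ ul_lt).
  by have := slackK of' k0; rewrite /top_gap -ul; clear -ul_lt; lia.
(* [X] has [c + 1 > 0] balls, so [j] now holds a second-heaviest one; [l] still does thanks to its
   reserve. *)
have sj' : slack f' j < top_gap.
  have [x Xx] : exists x, x \in X by apply/card_gt0P; rewrite cX.
  by apply: (no_top j x); rewrite ?ffunE ?Xx //; apply/eqP/Xw.
have sl' : slack f' l < top_gap.
  have [x fx wx] : exists2 x, f' x = l & wt x = u l.
    apply: weight_count_gt0; rewrite -/(own f' l).
    have := leq_pmull V stuck_gt0; clear -ownl ownl'; lia.
  by apply: (no_top l x); rewrite ?wx.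
have sub k : stuck f' k -> stuck f k && (k != j).
  case/and3P=> k0 uk sk.
  have kj : k != j by apply: contraTneq sk => ->; rewrite -ltnNge.
  have kl : k != l by apply: contraTneq sk => ->; rewrite -ltnNge.
  by rewrite kj andbT; apply/and3P; rewrite -e.
have lt_stuck : #|stuck f'| < #|stuck f|.
  have st_j : j \in stuck f := stj.
  rewrite [ltnRHS](cardD1 j) st_j ltnS; apply: subset_leq_card.
  by apply/subsetP => k /sub /andP[? ?]; apply/andP; split.
exists f' => //; split=> //.
- have := leq_mul lt_stuck (leqnn V); rewrite mulSn.
  by clear -ownl ownl'; lia.
- move=> k stk; have /andP[stk' kj] := sub k stk.
  rewrite owno ?owns //; apply: contraTneq stk => ->.
  by apply/and3P => -[_ _]; rewrite leqNgt sl'.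
(* Among the light owners only [l] has gained slack. Its bound [top_gap] is the gap above
   [second_weight], since no weight lies strictly between that and [V]. *)
- move=> k k0 ukV; have [->|kl] := eqVneq k l.
    have := next_weight_gt ul_lt; rewrite /gap ul_lt ul.
    suff -> : next_weight second_weight = V by [].
    apply/eqP; rewrite eqn_leq wgt_le leqNgt; apply/negP => lt.
    have := next_weight_gt (second_weight_lt (leq_ltn_trans (leq0n _) lt)).
    by rewrite ltnNge leq_bigmax_cond.
  have kj : k != j by apply: contraTneq ukV => ->; rewrite uj ltnn.
  by rewrite e // gaps.
Qed.

Lemma exists_tight l f : topped l f -> l != i0 -> u l = second_weight ->
  exists2 f', opt f' & forall j, j != i0 -> slack f' j < gap (u j).
Proof.
move=> + l0 ul; have [m] := ubnP #|stuck f|; elim: m f => // m IHm f ltm tf.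
case: (pickP (stuck f)) => [j stj|none].
  have [f' tf' lt'] := unstick tf l0 ul stj.
  by apply: IHm tf'; lia.
have [of_ _ _ _ gaps] := tf; exists f => // j j0.
have [ujV|] := ltnP (u j) V; first exact: gaps.
rewrite leq_eqVlt ltnNge wgt_le orbF => /eqP ujV; rewrite /gap -ujV ltnn ltnNge.
by apply/negP => sj; have /and3P[] := none j; rewrite -ujV eqxx.
Qed.

End Owners.

(** * Bounding the total slack *)

Lemma core_bound f0 vmax : opt f0 -> wgt vmax = V -> 1 < #|I| ->
    #|I| ^ 3 * V * (2 * #|I| + V) <= d ->
  exists f v, [/\ opt f, wgt v = V, exists i, wgt i < V &
    \sum_(j | j != i0) slack f j <= \sum_(i | i != v) (gap vmax (wgt i)).-1].
Proof.
move=> of0 vmaxV n_gt1 d_large.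
have [j0 j00] : exists j, j != i0.
  have : 0 < #|[set~ i0]| by rewrite cardsC1; lia.
  by case/card_gt0P=> j; rewrite !inE; exists j.
have [y0 fy0 wy0] := exists_light_ball of0 j00.
have V0 : 0 < V := leq_ltn_trans (leq0n _) wy0.
have [f of_ rich] := exists_rich of0 V0.
have [v vV d_le] := exists_rich_label (opt_valid of_) vmaxV rich.
set n := #|I| in n_gt1 d_large d_le *.
(* [d] is at least [n * (2 * n ^ 3 * V + n ^ 2 * V ^ 2)] and at most
   [n * (copies f i0 v + n * V ^ 2)]. *)
have copies_large : 2 * (n ^ 3 * V) <= copies f i0 v.
  have n_gt0 : 0 < n by lia.
  rewrite -(leq_pmul2l n_gt0).
  have e1 : n ^ 3 * V * (2 * n + V) = n * (2 * (n ^ 3 * V)) + n * (n ^ 2 * V ^ 2).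
    by rewrite !expnS !expn0; lia.
  have : n * (n * V ^ 2) <= n * (n ^ 2 * V ^ 2).
    by rewrite leq_mul2l leq_mul2r expnS leq_pmulr ?orbT // expn1.
  by lia.
have nV_gt0 : 0 < n ^ 3 * V by rewrite muln_gt0 expn_gt0 V0 (ltnW n_gt1).
(* The threshold [3 * n * V] is the supply of own balls needed for pushing; the factor 4 in
   [exists_owner] makes [2 * n ^ 3 * V] copies suffice. *)
have tau_E : 3 * n * V * n ^ 2 = 3 * (n ^ 3 * V).
  by rewrite !expnS !expn0; lia.
have tau_d : 3 * n * V * n ^ 2 < d.
  rewrite tau_E (leq_trans _ d_large) // mulnC ltn_pmul2l //; lia.
have tau_c : 3 * n * V * n ^ 2 < 4 * copies f i0 v by rewrite tau_E; lia.
have [sigma [sigma_inj sigma_i0 cop]] :=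
  exists_owner (opt_valid of_) n_gt1 tau_c tau_d.
have si0 : wgt (sigma i0) = V by rewrite sigma_i0.
have own_ge k : 3 * n * V <= own sigma f k.
  rewrite (leq_trans (cop k)) // /own weight_count_label (bigD1 (sigma k)) //=.
  exact: leq_addr.
have [f1 [of1 own1 gap1]] := exists_pushed vmaxV sigma_inj si0 of_ V0 own_ge.
have light_gt0 : 0 < #|[pred i | wgt i < V]|.
  by apply/card_gt0P; exists (lab y0).
have [i2 i2V second_i2] := eq_bigmax_cond wgt light_gt0.
have [l ul] := owner_of sigma_inj i2.
have ul2 : wgt (sigma l) = second_weight by rewrite ul.
have l0 : l != i0.
  by apply: contraTneq i2V => e; rewrite !inE -ul e si0 ltnn.
have tf1 : topped vmax sigma l f1.
  split=> //.
  - by have := own1 i0; lia.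
  - by apply: leq_trans (own1 l); rewrite leq_add2r leq_mul2r max_card orbT.
  - by move=> j _; apply: leq_trans (own1 j); nia.
  - by move=> j jn ujV; rewrite /gap ujV; apply: gap1.
have [f2 of2 gap2] := exists_tight vmaxV si0 tf1 l0 ul2.
exists f2, v; split=> //; first by exists (lab y0).
rewrite [leqRHS](reindex_inj sigma_inj) /=.
rewrite [leqRHS](eq_bigl (fun j => j != i0)); last first.
  by move=> j; rewrite -sigma_i0 (inj_eq sigma_inj).
by apply: leq_sum => j jn; have := gap2 j jn; lia.
Qed.

End MinimalOverload.

(** * The sum of the gaps *)

Section PartitionConstantBound.

Variables (n : nat) (w : n.-tuple nat).

Local Notation wgt := (tnth w).
Local Notation V := (head 0 w).

Lemma count_tuple (P : pred nat) : count P w = #|[set i | P (wgt i)]|.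
Proof.
by rewrite -sum1_count big_tuple -sum1_card; apply: eq_bigl => i; rewrite inE.
Qed.

Lemma count_leq_anti j j' : j <= j' -> count (leq j') w <= count (leq j) w.
Proof. by move=> jj'; apply: sub_count => x /=; apply: leq_trans. Qed.

Lemma mem_conj_part j : 0 < j <= V -> count (leq j) w \in conj_part w.
Proof.
by case/andP=> j0 jV; apply: map_f; rewrite mem_iota j0 add1n ltnS.
Qed.

Lemma conj_mult_ge h a b : a <= b <= V ->
    (forall j, a < j <= b -> count (leq j) w = h) ->
  b - a <= count_mem h (conj_part w).
Proof.
case/andP=> ab bV ch; rewrite count_map.
have -> : V = a + ((b - a) + (V - b)) by lia.
rewrite iotaD iotaD !count_cat.
rewrite (_ : count _ (iota (1 + a) (b - a)) = b - a); first by lia.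
rewrite -[RHS](size_iota (1 + a)); apply/eqP; rewrite -all_count.
by apply/allP => j; rewrite mem_iota /= => jab; rewrite ch ?eqxx //; lia.
Qed.

Lemma sorted_conj_part : sorted geq (conj_part w).
Proof.
apply: (homo_sorted (e := ltn)) (iota_ltn_sorted _ _).
by move=> x y xy; apply: count_leq_anti; apply: ltnW.
Qed.

Lemma sorted_conj_heights : sorted gtn (conj_heights w).
Proof.
apply: sorted_filter; first exact: rev_trans ltn_trans.
rewrite gtn_sorted_uniq_geq undup_uniq /=.
apply: subseq_sorted (undup_subseq _) sorted_conj_part.
exact: rev_trans leq_trans.
Qed.

Lemma mem_conj_heights i : wgt i < V -> count (leq (wgt i).+1) w \in conj_heights w.
Proof.
move=> iV; rewrite mem_filter mem_undup mem_conj_part // andbT size_tuple.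
rewrite count_tuple -[X in _ < X]card_ord -cardsT proper_card //.
by apply/properP; split; [apply: subsetT|exists i; rewrite !inE ?ltnn].
Qed.

Lemma conj_heights_mem h : h \in conj_heights w ->
  exists2 j, 0 < j <= V & h = count (leq j) w.
Proof.
rewrite mem_filter mem_undup => /andP[_ /mapP[j]].
by rewrite mem_iota add1n ltnS; exists j.
Qed.

Lemma nth_conj_heights_lt t t' : t < t' < size (conj_heights w) ->
  nth 0 (conj_heights w) t' < nth 0 (conj_heights w) t.
Proof.
case/andP=> tt' t'k; apply: (sorted_ltn_nth _ 0 sorted_conj_heights) => //.
- exact: rev_trans ltn_trans.
- by rewrite inE (ltn_trans tt').
Qed.

(** [count (leq (wgt i).+1) w] is the number of labels heavier than [i]. Labels sharing this number
    share a weight, and together with the heavier ones they number at most the preceding height. *)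
Lemma card_level_le t : t < size (conj_heights w) ->
  #|[set i | (wgt i < V) && (count (leq (wgt i).+1) w == conj_height w t.+1)]|
    <= conj_height w t - conj_height w t.+1.
Proof.
move=> tk; set S := [set i | _]; have [->|[i]] := set_0Vmem S; first by rewrite cards0.
rewrite inE => /andP[iV /eqP ci].
(* For [t > 0] the preceding height is the count at some level [j]; if [j] exceeded [wgt i], that
   count would be at most the next, smaller height. *)
have le_c : count (leq (wgt i)) w <= conj_height w t.
  case: t tk {S} ci => [|t] tk ci; first exact: count_size.
  have th : nth 0 (conj_heights w) t \in conj_heights w by rewrite mem_nth // ltnW.
  have [j _ ej] := conj_heights_mem th.
  rewrite /conj_height /= ej; apply: count_leq_anti.
  rewrite leqNgt; apply/negP => /count_leq_anti; rewrite -ej ci leqNgt /conj_height /=.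
  by rewrite nth_conj_heights_lt ?tk ?andbT.
suff : #|S| + conj_height w t.+1 <= count (leq (wgt i)) w by lia.
rewrite -ci !count_tuple -cardsUI.
have -> : S :&: [set i0 | wgt i < wgt i0] = set0.
  apply/setP => k; rewrite !inE; apply/negP => /andP[/andP[_ /eqP ck] ik].
  have : count (leq (wgt k).+1) w < count (leq (wgt i).+1) w.
    rewrite !count_tuple; apply: proper_card; apply/properP; split.
      by apply/subsetP => l; rewrite !inE; apply: ltn_trans.
    by exists k; rewrite !inE ?ltnn.
  by rewrite ck ci ltnn.
rewrite cards0 addn0; apply: subset_leq_card; apply/subsetP => k; rewrite !inE.
case/orP=> [/andP[_ /eqP ck]|/ltnW //]; rewrite leqNgt; apply/negP => ki.
have : count (leq (wgt i).+1) w < count (leq (wgt k).+1) w.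
  rewrite !count_tuple; apply: proper_card; apply/properP; split.
    by apply/subsetP => l; rewrite !inE; apply: ltn_trans.
  by exists i; rewrite !inE ?ltnn.
by rewrite ck ci ltnn.
Qed.

Lemma sum_levels_le (G : nat -> nat) :
  \sum_(i | wgt i < V) G (count (leq (wgt i).+1) w)
    <= \sum_(1 <= t < (size (conj_heights w)).+1)
         (conj_height w t.-1 - conj_height w t) * G (conj_height w t).
Proof.
set k := size _; rewrite big_add1 big_mkord /=.
apply: (@leq_trans (\sum_(i | wgt i < V)
   \sum_(t < k | count (leq (wgt i).+1) w == conj_height w t.+1)
     G (conj_height w t.+1))).
  apply: leq_sum => i iV; have h_in := mem_conj_heights iV.
  have tk : index (count (leq (wgt i).+1) w) (conj_heights w) < k by rewrite index_mem.
  have et : conj_height w (Ordinal tk).+1 = count (leq (wgt i).+1) w.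
    by rewrite /conj_height /= nth_index.
  by rewrite (bigD1 (Ordinal tk)) ?et //= leq_addr.
rewrite (exchange_big_dep xpredT) //=; apply: leq_sum => t _.
rewrite sum_nat_const leq_mul2r; apply/orP; right.
rewrite (leq_trans _ (card_level_le (ltn_ord t))) //.
by apply: subset_leq_card; apply/subsetP => i; rewrite !inE.
Qed.

Hypothesis w_sorted : sorted geq w.

Lemma wgt_le_head i : wgt i <= V.
Proof.
case: n w w_sorted i => [|m] s s_sorted i; first by case: i.
rewrite (tnth_nth 0) -nth0.
apply: (sorted_leq_nth _ _ 0 s_sorted); rewrite ?inE ?size_tuple //.
  exact: rev_trans leq_trans.
exact: leqnn.
Qed.

(** Between consecutive weights the conjugate partition is constant, so each gap is at most a
    multiplicity. Light labels give the sum over [t], and the labels of weight [V] other than [v]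
    give the last term. *)
Lemma sum_gap_le (vmax v : 'I_n) :
    wgt vmax = V -> wgt v = V -> (exists i, wgt i < V) ->
  \sum_(i | i != v) (gap wgt V vmax (wgt i)).-1 <= b_const w.
Proof.
move=> vmaxV vV [i0 i0V]; set A := fun h => count_mem h (conj_part w).
have h_in := mem_conj_heights i0V.
have k_gt0 : 0 < size (conj_heights w) by case: (conj_heights w) h_in.
have gap_low i : wgt i < V -> gap wgt V vmax (wgt i) <= A (count (leq (wgt i).+1) w).
  move=> iV; rewrite /gap iV; apply: conj_mult_ge.
    rewrite (ltnW (next_weight_gt vmaxV iV)) /= -[leqRHS]vmaxV.
    by apply: (next_weight_le wgt_le_head vmaxV); rewrite vmaxV.
  move=> j /andP[ij jn]; apply: eq_in_count => x /tnthP[k ->] /=.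
  apply/idP/idP => [|ik]; first exact: leq_trans.
  by apply: leq_trans jn _; apply: (next_weight_le wgt_le_head vmaxV).
have gap_top : gap wgt V vmax V <= A (count (leq V) w).
  rewrite /gap ltnn; apply: conj_mult_ge.
    by rewrite leqnn andbT ltnW // second_weight_lt //; lia.
  move=> j /andP[sj jV]; apply: eq_in_count => x /tnthP[k ->] /=.
  apply/idP/idP => [jk|]; last exact: leq_trans.
  rewrite leqNgt; apply/negP => kV.
  have := @leq_bigmax_cond _ (fun i => wgt i < V) wgt k kV.
  by rewrite -/(second_weight _ _); lia.
(* The smallest height is the count at level [V]; the light label [i0] keeps it below [n], so that
   it belongs to [conj_heights w]. *)
have hk : conj_height w (size (conj_heights w)) = count (leq V) w.
  have V_in : count (leq V) w \in conj_heights w.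
    rewrite mem_filter mem_undup mem_conj_part; last by lia.
    rewrite andbT (leq_ltn_trans (count_leq_anti i0V)) //.
    by move: h_in; rewrite mem_filter => /andP[].
  rewrite /conj_height -(prednK k_gt0) /=.
  have last_in : nth 0 (conj_heights w) (size (conj_heights w)).-1 \in conj_heights w.
    by rewrite mem_nth // prednK.
  have [j /andP[_ jV] ej] := conj_heights_mem last_in.
  apply/eqP; rewrite eqn_leq {2}ej count_leq_anti // andbT.
  move: (V_in); rewrite -index_mem => ltk; rewrite -[leqRHS](nth_index 0 V_in).
  have [->//|ne] := eqVneq (index (count (leq V) w) (conj_heights w))
                           (size (conj_heights w)).-1.
  by apply/ltnW/nth_conj_heights_lt; rewrite ltn_neqAle ne -ltnS prednK ?leqnn // ltk.
rewrite (bigID (fun i => wgt i < V)) /= /b_const.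
have -> : (size (conj_heights w) == 0) = false by lia.
apply: leq_add.
  apply: leq_trans (sum_levels_le (fun h => A h - 1)).
  rewrite (eq_bigl (fun i => wgt i < V)); last first.
    by move=> i; case: eqVneq => // ->; rewrite vV ltnn.
  by apply: leq_sum => i iV; have := gap_low i iV; lia.
rewrite /conj_mult hk; apply: (@leq_trans
  (\sum_(i | (i != v) && ~~ (wgt i < V)) (A (count (leq V) w) - 1))).
  apply: leq_sum => i /andP[_]; rewrite -leqNgt => Vi.
  by have -> : wgt i = V; [apply/eqP; rewrite eqn_leq wgt_le_head|lia].
rewrite sum_nat_const leq_mul2r count_tuple (cardsD1 v) inE vV leqnn addKn.
apply/orP; right; rewrite eq_leq //; apply: eq_card => i.
by rewrite unfold_in /= -leqNgt !inE.
Qed.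

End PartitionConstantBound.

(** * Feasibility of the partitioning problem *)

Lemma card_label (n d : nat) (v : 'I_n) :
  #|[set b : 'I_n * 'I_d | b.1 == v]| = d.
Proof.
have -> : [set b : 'I_n * 'I_d | b.1 == v] = setX [set v] [set: 'I_d].
  by apply/setP => -[i j]; rewrite !inE andbT.
by rewrite cardsX cards1 cardsT card_ord mul1n.
Qed.

Import Order.TTheory GRing.Theory Num.Theory.

Theorem theorem1p10 (n : nat) (n_gt0 : 0 < n)
    (w : n.-tuple nat) (w_sorted : sorted geq w)
    (d : nat) (d_gt0 : 0 < d) (d_large : d1_bound n w <= d)
    (C : n.-tuple int) (C_sorted : sorted >=%R C)
    (C_1feasible : k_feasible d 1 C w)
    (C_sum : ((d * (\sum_(i < n) tnth w i) + b_const w)%N%:Z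
                <= \sum_(i < n) tnth C i)%R) :
  feasible d C w.
Proof.
have [f0 [asg0 le0]] := C_1feasible.
(* Capacities other than that of [i0] bound loads of [f0], so they are nonnegative and the absolute
   value keeps them. *)
pose i0 := Ordinal n_gt0; pose K (j : 'I_n) := `|tnth C j|%N.
have KE j : j != i0 -> Posz (K j) = tnth C j.
  move=> j0; have j_gt0 : 0 < j by rewrite lt0n.
  by have := le0 j j_gt0; rewrite /K; lia.
pose T : finType := ('I_n * 'I_d)%type; pose lab : T -> 'I_n := fst.
have v0 : valid lab d (tnth w) K i0 f0.
  apply/andP; split; first by apply/forallP => k; apply/eqP/asg0.
  apply/forall_inP => j j0; have j_gt0 : 0 < j by rewrite lt0n.
  by have := le0 j j_gt0; rewrite -KE // lez_nat.
case: (arg_minnP (fun f => load lab (tnth w) f i0) v0) => f vf minf.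
set mu := load lab (tnth w) f i0 in minf.
have of_ : opt lab d (tnth w) K i0 mu f by rewrite /opt vf eqxx.
have [le_mu|lt_mu] := lerP (Posz mu) (tnth C i0).
  exists f; split; first by move=> k; apply: card_bin vf.
  move=> k; have [->//|k0] := eqVneq k i0.
  by rewrite -KE // lez_nat; apply: load_le vf k0.
have mu_gt j : j != i0 -> K j < mu.
  move=> j0; suff : (tnth C j <= tnth C i0)%R by have := KE _ j0; lia.
  rewrite !(tnth_nth 0%R).
  apply: (sorted_leq_nth _ _ _ C_sorted); rewrite ?inE ?size_tuple //.
    exact: rev_trans le_trans.
  exact: lexx.
have lab_card v : #|[set b | lab b == v]| = d := card_label d v.
have tot f' := sum_load (tnth w) lab_card f'.
exfalso; move: C_sum; rewrite [X in (_ <= X)%R](bigD1 i0) //=.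
rewrite (eq_bigr (fun j => Posz (K j))); last by move=> j /KE.
rewrite -(big_morph Posz PoszD (erefl (Posz 0))).
(* A single bin holds every ball, so [mu] is [d] times the weight sum, contradicting [lt_mu]. *)
have [n1|n_gt1] := leqP n 1.
  have noj j : j != i0 -> False.
    by move=> /eqP[]; apply/val_inj => /=; have := ltn_ord j; lia.
  rewrite [\sum_(j < n | j != i0) K j]big1; last by move=> j /noj.
  have := tot f; rewrite (bigD1 i0) //= -/mu big1; last by move=> j /noj.
  by lia.
have wV := wgt_le_head w_sorted.
have vmaxV : tnth w i0 = head 0 w by rewrite (tnth_nth 0) nth0.
have card_gt1 : 1 < #|'I_n| by rewrite card_ord.
have d_large' : #|'I_n| ^ 3 * head 0 w * (2 * #|'I_n| + head 0 w) <= d.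
  by rewrite card_ord.
have [f2 [v [of2 vV light le_gap]]] :=
  core_bound lab_card wV minf mu_gt of_ vmaxV card_gt1 d_large'.
have le_b := leq_trans le_gap (sum_gap_le w_sorted vmaxV vV light).
set ld := fun j : 'I_n => load lab (tnth w) f2 j.
set sl := fun j : 'I_n => slack lab (tnth w) K f2 j.
have sumK : \sum_(j < n | j != i0) K j
    = \sum_(j < n | j != i0) ld j + \sum_(j < n | j != i0) sl j.
  by rewrite -big_split; apply: eq_bigr => j j0; rewrite /= (slackK of2).
have tot2 : mu + \sum_(j < n | j != i0) ld j = d * \sum_(j < n) tnth w j.
  by have := tot f2; rewrite (bigD1 i0) //= (load_i0 of2).
have {}le_b : \sum_(j < n | j != i0) sl j <= b_const w := le_b.
have {}lt_mu : (tnth C i0 < Posz mu)%R := lt_mu.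
(* The total capacity is less than [mu] plus the other loads and slacks, hence less than the bound
   assumed in [C_sum]. *)
by rewrite sumK -tot2; clear -le_b lt_mu; lia.
Qed.
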